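(* Let $a_1>0$, let $\mu$ be a probability measure on $(0,\infty)$ with $\int_0^\infty|\ln\alpha|\,\mu(\mathrm{d}\alpha)<\infty$ and $K:=\int_0^\infty\ln\alpha\,\mu(\mathrm{d}\alpha)>0$. Let $\lambda>0$, let $(X_t)_{t\ge 0}$ be the drift process with multiplication jumps (defined in the context) with parameters $\lambda$, $v=\lambda a_1$ and jump factors distributed according to $\mu$, and set $$f_\infty(x):=\mathsf{P}\Bigl\{\liminf_{t\to\infty}X_t=+\infty\ \Big|\ X_0=x\Bigr\},\qquad x\in\mathbb{R}.$$ Then $f_\infty(x)=0$ for all $x\le 0$. Moreover, all derivatives of the function $f_\infty$ vanish at zero: $f_\infty^{(k)}(0)=0$ for $k=1,2,\dots$.
   Context: Construction of $X_t$. Let $0=\sigma_0<\sigma_1<\sigma_2<\dots$, where $\sigma_1,\sigma_2,\dots$ are the arrival times of a Poisson process with rate $\lambda>0$ (so $\sigma_i-\sigma_{i-1}$ are i.i.d. exponential with parameter $\lambda$). Let $\xi_1,\xi_2,\dots$ be i.i.d. real random variables, independent of the Poisson process, such that $e^{\xi_i}$ has distribution $\mu$. The process started at $X_0=x$ has right-continuous paths defined inductively by $$X_t=x-vt\ \ (0\le t<\sigma_1),\qquad X_t=e^{\xi_i}X_{\sigma_i-0}-v(t-\sigma_i)\ \ (\sigma_i\le t<\sigma_{i+1},\ i=1,2,\dots),$$ where $X_{\sigma_i-0}$ is the left limit at $\sigma_i$. The function $f_\infty$ is a bounded solution of the equation $a_1y'(x)+y(x)=\int_0^\infty y(\alpha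 x)\,\mu(\mathrm{d}\alpha)$, $x\in\mathbb{R}$.
   Formalization: For heavy-tailed μ the derivatives of f_∞ at 0 of order k≥2 may fail to exist, so existence of f_∞^{(k)}(0) is claimed only when ∫α^{k−1}μ(dα)<∞ (automatic for k=1); whenever the derivative exists, its value is 0 without this condition. *)

(* Defs.v *)
From HB Require Import structures.
From mathcomp Require Import all_boot all_order all_algebra.
From mathcomp Require Import all_classical all_reals all_analysis.

Set Implicit Arguments.
Unset Strict Implicit.
Unset Printing Implicit Defensive.

Import Order.TTheory GRing.Theory Num.Theory.
Import numFieldNormedType.Exports.

Local Open Scope classical_set_scope.
Local Open Scope ring_scope.

Definition has_law d (T : measurableType d) (R : realType)
    (P : probability T R) (X : T -> R) (Q : set R -> \bar R) : Prop :=
  forall A : set R, measurable A -> P (X @^-1` A) = Q A.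

Definition mutually_independent d (T : measurableType d) (R : realType)
    (P : probability T R) (X : nat -> T -> R) : Prop :=
  forall (s : seq nat) (B : nat -> set R),
    uniq s -> (forall i, measurable (B i)) ->
    P (\bigcap_(i in [set` s]) (X i @^-1` B i)) =
    (\prod_(i <- s) P (X i @^-1` B i))%E.

Definition generated_sigma_algebra (T : Type) (R : realType)
    (X : nat -> T -> R) : set (set T) :=
  <<s [set A | exists i (B : set R), measurable B /\ A = X i @^-1` B] >>.

Definition independent_sequences d (T : measurableType d) (R : realType)
    (P : probability T R) (X Y : nat -> T -> R) : Prop :=
  forall A B : set T,
    generated_sigma_algebra X A -> generated_sigma_algebra Y B ->
    P (A `&` B) = (P A * P B)%E.

(* [sigma 0 = 0] and [sigma i], i >= 1, are the arrival times of a Poisson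
   process: the spacings are i.i.d. exponential with parameter [lambda]. *)
Definition poisson_arrival_times d (T : measurableType d) (R : realType)
    (P : probability T R) (lambda : R) (sigma : nat -> T -> R) : Prop :=
  let spacing i w := sigma i.+1 w - sigma i w in
  [/\ forall w, sigma 0%N w = 0,
      forall i w, sigma i w < sigma i.+1 w,
      mutually_independent P spacing &
      forall i, has_law P (spacing i) (exponential_prob lambda)].

Section drift_path.
Context {R : realType}.
Variables (x v : R) (s z : nat -> R).
(* Deterministic part of the construction: [x] is the starting point, [s] the
   arrival times (with [s 0 = 0]); [z i] is the exponent used at the jump time
   [s i.+1], i.e. the number written $\xi_{i+1}$ with jumps counted from 1. *)

(* Position at the time [s i], just after the jump. *)
Fixpoint jump_position (i : nat) : R :=
  if i is j.+1 then expR (z j) * (jump_position j - v * (s j.+1 - s j)) else x.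

(* Index of the interval [s i, s i.+1[ containing [t]. It is 0 if there is no
   such interval: for the arrival times of a Poisson process and [t >= 0], this
   occurs only on the null event where they are bounded, and there the path
   tends to -oo. *)
Definition last_arrival (t : R) : nat := [get i | s i <= t < s i.+1].

Definition drift_path (t : R) : R :=
  jump_position (last_arrival t) - v * (t - s (last_arrival t)).

(* The inductive equations that characterize the path. *)
Hypothesis s_incr : forall i, s i < s i.+1.

Lemma last_arrivalE t i : s i <= t < s i.+1 -> last_arrival t = i.
Proof.
move=> /andP[it ti].
have le_s : {homo s : m n / (m <= n)%N >-> m <= n}.
  move=> m n /subnK <-; elim: (n - m)%N => // k IH.
  by rewrite addSn (le_trans IH)// ltW.
have : s (last_arrival t) <= t < s (last_arrival t).+1.
  rewrite /last_arrival; apply: (@getPex nat (fun i => s i <= t < s i.+1)).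
  by exists i; rewrite it.
move: (last_arrival t) => j /andP[jt tj].
have [ij|ji|//] := ltngtP j i.
- by have := le_lt_trans (le_trans (le_s _ _ ij) it) tj; rewrite ltxx.
- by have := le_lt_trans (le_trans (le_s _ _ ji) jt) ti; rewrite ltxx.
Qed.

Lemma drift_pathE t i : s i <= t < s i.+1 ->
  drift_path t = jump_position i - v * (t - s i).
Proof. by move=> /last_arrivalE it; rewrite /drift_path it. Qed.

Lemma drift_path_start t : s 0%N = 0 -> 0 <= t < s 1%N ->
  drift_path t = x - v * t.
Proof. by move=> s0 t1; rewrite (@drift_pathE _ 0%N) s0 ?subr0. Qed.

Lemma drift_path_left i : drift_path y @[y --> (s i.+1)^'-] -->
  jump_position i - v * (s i.+1 - s i).
Proof.
have nearE : \forall y \near (s i.+1)^'-,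
    jump_position i - v * (y - s i) = drift_path y.
  near=> y; rewrite (@drift_pathE _ i)//; apply/andP; split; last first.
    by near: y; exact: nbhs_left_lt.
  by near: y; exact: nbhs_left_ge.
apply: cvg_trans; first exact: (near_eq_cvg nearE).
apply: cvg_at_left_filter.
apply: cvgB; first exact: cvg_cst.
apply: cvgM; first exact: cvg_cst.
by apply: cvgB; [exact: cvg_id|exact: cvg_cst].
Unshelve. all: by end_near. Qed.

Lemma drift_path_jump t i : s i.+1 <= t < s i.+2 ->
  drift_path t =
    expR (z i) * lim (drift_path y @[y --> (s i.+1)^'-]) - v * (t - s i.+1).
Proof.
move=> it; rewrite (drift_pathE it)/=; congr (_ * _ - _).
by apply/esym/cvg_lim => //; exact: drift_path_left.
Qed.

End drift_path.

Definition drift_process d (T : measurableType d) (R : realType)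
    (v : R) (sigma xi : nat -> T -> R) (x t : R) (w : T) : R :=
  drift_path x v (sigma^~ w) (xi^~ w) t.

(* The probability that liminf X_t = +oo for the process started at [x]. *)
Definition f_infty d (T : measurableType d) (R : realType)
    (P : probability T R) (v : R) (sigma xi : nat -> T -> R) (x : R) : R :=
  fine (P [set w |
    limf_einf (fun t : R => (drift_process v sigma xi x t w)%:E) +oo%R = +oo%E]).

(* [f] is [k] times differentiable at [x]. The operator [derive1n] is total (a
   nonconvergent difference quotient gets a default limit), so the existence of
   derivatives has to be expressed separately. It does not hold for [f_infty]
   at 0 and k >= 2 without a moment condition on the law of exp xi_1: if
   P(exp xi_1 > y) = (1 + ln y)^-3 for y >= 1, then f_infty 0 = 0 and
   f_infty x / x^2 -> +oo as x -> 0+. *)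
Fixpoint times_derivable (R : realType) (k : nat) (f : R -> R) (x : R) : Prop :=
  if k is j.+1 then
    (\forall y \near x, times_derivable j f y) /\ derivable (derive1n j f) x 1
  else True.

(* Main.v *)
Require Import Defs.
From HB Require Import structures.
From mathcomp Require Import all_boot all_order all_algebra.
From mathcomp Require Import all_classical all_reals all_analysis.
From mathcomp Require Import measurable_realfun ring lra.
Import Order.TTheory GRing.Theory Num.Theory.
Import numFieldNormedType.Exports.
Local Open Scope classical_set_scope.
Local Open Scope ring_scope.

(** Between two jumps the path decreases, so its infimum there is its left limit
at the next jump; hence liminf X_t = +oo means that the arrival times diverge and
the positions just before the jumps tend to +oo. This event is unchanged when the
first jump is removed and the starting point x is replaced by the position
e^(xi_1) (x - v sigma_1) after it. As the remaining spacings and factors are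
independent of the first ones and have the law of the original sequences,
f x = E F (x - v sigma_1) with F y = E f (e^(xi_1) y).

The exponential law is memoryless and F is nondecreasing (since f is), so for
t >= 0 and e = 1 - exp (- t / a1) this gives
  e F x + (1 - e) f x <= f (x + t) <= e F (x + t) + (1 - e) f x.
Hence f is Lipschitz, then F is continuous, then f is differentiable with
a1 f' + f = F. If alpha^(k-1) has a finite mean, differentiating under the
integral gives inductively
  a1 f^(j+1) (x) + f^(j) (x) = E alpha^j f^(j) (alpha x),   j < k,
with all these functions bounded, so f is k times differentiable everywhere.

Since f vanishes on the negative half-line, each derivative at 0 is 0, being a
limit from the left; a default limit is 0 as well. *)

Set Implicit Arguments.
Unset Strict Implicit.

(** * The deterministic path at infinity *)

(** Here [u.1] holds the spacings between jumps and [u.2] the factors exp xi. In these data,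
    removing the first jump is a plain shift of both sequences. *)
Fixpoint position {R : realType} (v x : R) (u : (nat -> R) * (nat -> R)) i : R :=
  if i is j.+1 then u.2 j * (position v x u j - v * u.1 j) else x.

(** The quantity compared with [n] in the first clause is the left limit at the next jump. All
    quantifiers range over [nat], which makes the set a countable combination of measurable
    conditions, jointly in the starting point and the data. *)
Definition escape {R : realType} (v : R) : set (R * ((nat -> R) * (nat -> R))) :=
  [set p | (forall n : nat, exists N : nat, forall i, (N <= i)%N ->
             n%:R <= position v p.1 p.2 i - v * p.2.1 i) /\
           (forall n : nat, exists i : nat, n%:R <= \sum_(j < i) p.2.1 j)].

Definition shift_seqs {R : realType} (u : (nat -> R) * (nat -> R)) :=
  (fun i => u.1 i.+1, fun i => u.2 i.+1).

Lemma exists_nat_gt {R : realType} (r : R) : exists n : nat, r < n%:R.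
Proof.
by have [m _ mr] := nbhs_infty_gtr r; exists m; apply: mr => /=; exact: leqnn.
Qed.

Lemma position_shift {R : realType} (v x : R) u i :
  position v (u.2 0%N * (x - v * u.1 0%N)) (shift_seqs u) i = position v x u i.+1.
Proof. by elim: i => [//|i IH]; rewrite /= IH. Qed.

Lemma escape_shift {R : realType} (v x : R) u :
  escape v (u.2 0%N * (x - v * u.1 0%N), shift_seqs u) <-> escape v (x, u).
Proof.
have sumS i : \sum_(j < i.+1) u.1 j = u.1 0%N + \sum_(j < i) (shift_seqs u).1 j.
  by rewrite big_ord_recl.
split=> -[/= H1 H2]; split => /= n.
- have [N HN] := H1 n; exists N.+1 => -[//|i] Ni.
  by have := HN i Ni; rewrite position_shift.
(* Asking for [n + m] leaves room for the first spacing, by which the two partial sums differ. *)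
- have [m um] : exists m : nat, - u.1 0%N <= m%:R.
    by have [m /ltW] := exists_nat_gt (- u.1 0%N); exists m.
  have [i Hi] := H2 (n + m)%N; exists i.+1; rewrite sumS.
  move: Hi um; rewrite natrD /=; move: (\sum_(_ < _) _) => S; lra.
- have [N HN] := H1 n; exists N => i Ni.
  by rewrite position_shift; apply: HN; exact: leqW.
- have [m um] : exists m : nat, u.1 0%N <= m%:R.
    by have [m /ltW] := exists_nat_gt (u.1 0%N); exists m.
  have [[|i]] := H2 (n + m)%N; first last.
    move=> Hi; exists i; move: Hi um; rewrite natrD sumS /=.
    by move: (\sum_(_ < _) _) => S; lra.
  (* If the sum reaching [n + m] is empty, then [n = 0] and the empty sum serves again. *)
  rewrite big_ord0 => nm; exists 0%N; rewrite big_ord0.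
  by move: nm; rewrite !lern0 addn_eq0 => /andP[].
Qed.

Lemma escape_homo {R : realType} (v x y : R) (u : (nat -> R) * (nat -> R)) :
  (forall i, 0 <= u.2 i) -> x <= y -> escape v (x, u) -> escape v (y, u).
Proof.
move=> u0 xy [H1 H2]; split=> // n; have [N HN] := H1 n; exists N => i Ni.
apply: le_trans (HN i Ni) _; rewrite lerD2r /= => {Ni}.
by elim: i => [//|i IH]; rewrite ler_wpM2l// lerD2r.
Qed.

(** From a nonpositive start, downward drift and nonnegative factors keep every position
    nonpositive, so even the threshold 1 is never reached. *)
Lemma escape_gt0 {R : realType} (v x : R) (u : (nat -> R) * (nat -> R)) :
  0 <= v -> (forall i, 0 <= u.1 i) -> (forall i, 0 <= u.2 i) ->
  escape v (x, u) -> 0 < x.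
Proof.
move=> v0 u1 u2 [/(_ 1%N)[N HN] _]; rewrite ltNge; apply/negP => x0.
have pos0 i : position v x u i <= 0.
  elim: i => [//|i IH] /=; rewrite mulr_ge0_le0// subr_le0.
  by apply: le_trans IH _; rewrite mulr_ge0.
have := HN N (leqnn N); rewrite /= => H.
have := le_trans H (lerB (pos0 N) (mulr_ge0 v0 (u1 N))).
by rewrite subr0 ler10.
Qed.

Lemma limf_einf_pinfty {R : realType} (g : R -> R) :
  limf_einf (fun t => (g t)%:E) +oo%R = +oo%E <->
  forall M, \forall t \near +oo%R, M <= g t.
Proof.
rewrite limf_einfE; split=> [gy M|H].
  have : (M%:E < ereal_sup [set ereal_inf ((fun t => (g t)%:E) @` V) | V in +oo%R])%E.
    by rewrite gy ltry.
  move/ereal_sup_gt => [_ [V FV <-]] MV.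
  apply: filterS FV => t Vt; rewrite -lee_fin.
  by apply: (le_trans (ltW MV)); apply: ereal_inf_lbound; exists t.
apply: eq_infty => M.
apply: (@le_trans _ _ (ereal_inf ((fun t => (g t)%:E) @` [set t | M <= g t]))).
  by apply: le_ereal_inf_tmp => _ [t Mt <-]; rewrite lee_fin.
by apply: ereal_sup_ubound; exists [set t | M <= g t] => //; exact: H.
Qed.

Section drift_path_at_infinity.
Context {R : realType}.
Variables (x v : R) (s z : nat -> R).
Hypotheses (v0 : 0 < v) (s0 : s 0%N = 0) (s_incr : forall i, s i < s i.+1).

Let u : (nat -> R) * (nat -> R) := (fun i => s i.+1 - s i, fun i => expR (z i)).

Let positionE i : position v x u i = jump_position x v s z i.
Proof. by elim: i => [//|i IH] /=; rewrite IH. Qed.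

Let sE i : \sum_(j < i) u.1 j = s i.
Proof.
elim: i => [|i IH]; first by rewrite big_ord0 s0.
by rewrite big_ord_recr IH /= addrC subrK.
Qed.

Let le_s : {homo s : m n / (m <= n)%N >-> m <= n}.
Proof. by apply/nondecreasing_seqP => n; exact/ltW/s_incr. Qed.

(** The default index of [last_arrival] is 0. After bounded arrival times the path is therefore pure
    drift to -oo, which excludes them from the liminf event. *)
Lemma drift_path_out t : (forall i, ~~ (s i <= t < s i.+1)) ->
  drift_path x v s z t = x - v * t.
Proof.
move=> H; rewrite /drift_path /last_arrival.
have -> : get (fun i => s i <= t < s i.+1) = 0%N.
  by apply: xgetPN => i it; move: (H i); rewrite it.
by rewrite /= s0 subr0.
Qed.

Lemma last_arrival_ex t N : s N <= t -> (exists i, t < s i) ->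
  exists2 i, (N <= i)%N & s i <= t < s i.+1.
Proof.
move=> Nt ex; case: (ex_minnP ex) => -[|i] ti imin.
  by have := lt_le_trans ti (le_s (leq0n N)); rewrite ltNge Nt.
exists i.
  rewrite leqNgt; apply/negP => iN.
  by have := le_lt_trans Nt (lt_le_trans ti (le_s iN)); rewrite ltxx.
rewrite ti andbT leNgt; apply/negP => /imin.
by rewrite ltnn.
Qed.

Lemma liminf_drift_path :
  limf_einf (fun t => (drift_path x v s z t)%:E) +oo%R = +oo%E <-> escape v (x, u).
Proof.
rewrite limf_einf_pinfty; split=> [H|[H1 H2] M].
(* Otherwise the path is eventually [x - v * t], hence below the threshold [x]. *)
- have unb A : exists i, A < s i.
    apply/not_existsP => sb.
    have [B [Breal HB]] := H x.
    (* Beyond [B] the path is at least [x], beyond [A] no interval contains [t], and [t > 0] makes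
       the drift strict. *)
    pose t := Num.max (B + 1) (Num.max (A + 1) 1).
    have tB : B < t by rewrite /t lt_max ltrDl ltr01.
    have tA : A < t by rewrite /t !lt_max ltrDl ltr01 orbT.
    have t0 : 0 < t by rewrite /t !lt_max ltr01 !orbT.
    have := HB _ tB; rewrite drift_path_out => [|i].
      by rewrite lerBrDl gerDr leNgt mulr_gt0.
    apply/negP => /andP[_ ti]; apply: (sb i.+1); exact: lt_trans tA ti.
  split=> n /=; last first.
    by have [i ni] := unb n%:R; exists i; rewrite sE ltW.
  have [B [Breal HB]] := H n%:R; have [N BN] := unb B; exists N => i Ni.
  have Bi : B < s i by apply: lt_le_trans BN _; exact: le_s.
  rewrite positionE; set p := jump_position _ _ _ _ _.
  have drE t : s i <= t < s i.+1 -> n%:R <= p - v * (t - s i).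
    move=> it; have /andP[it' _] := it.
    by rewrite -(drift_pathE _ _ _ s_incr it); apply: HB; exact: lt_le_trans it'.
  have pn : n%:R <= p.
    by have := drE (s i); rewrite lexx s_incr subrr mulr0 subr0; exact.
  rewrite leNgt; apply/negP => lt_n.
  (* The midpoint of [n] and a left limit below [n] would be attained inside the interval, at time
     [s i + (p - M') / v]. *)
  pose M' := (n%:R + (p - v * (s i.+1 - s i))) / 2.
  have : n%:R <= p - v * ((s i + (p - M') / v) - s i).
    apply: drE; rewrite lerDl divr_ge0 ?ltW//=; last by rewrite /M'; lra.
    rewrite -ltrBrDl ltr_pdivrMr // [_ * v]mulrC /M'; lra.
  rewrite addrAC subrr add0r mulrCA divff ?gt_eqF// mulr1 /M'; lra.
- have [n Mn] : exists n : nat, M <= n%:R.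
    by have [m /ltW] := exists_nat_gt M; exists m.
  have [N HN] := H1 n.
  exists (s N); split; first exact: num_real.
  move=> t Nt.
  have [|i Ni it] := @last_arrival_ex t N (ltW Nt).
    have [m tm] : exists m : nat, t < m%:R.
      exact: exists_nat_gt.
    have [i Hi] := H2 m; exists i; apply: lt_le_trans tm _.
    by rewrite -(sE i).
  rewrite (drift_pathE _ _ _ s_incr it); apply: le_trans Mn _.
  apply: le_trans (HN i Ni) _; rewrite /= positionE lerD2l lerN2.
  by rewrite ler_pM2l// lerD2r; case/andP: it => _ /ltW.
Qed.

End drift_path_at_infinity.

(** * The law of the jump data and the renewal equation *)

(** Uniqueness of finite measures on a generating pi-system, for the law of [f] restricted to [D]
    and the multiple [c * m]. With [D] an event on the first data it yields independence of the
    rest; with [c] an exponential it yields memorylessness. *)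
Lemma scaled_law_unique d d' (T : measurableType d) (T' : measurableType d')
    (R : realType) (P : probability T R) (m : {measure set T' -> \bar R})
    (D : set T) (f : T -> T') (c : \bar R) (G : set (set T')) :
  measurable D -> measurable_fun setT f -> (0 <= c)%E -> c \is a fin_num ->
  @measurable _ T' = <<s G >> -> setI_closed G -> G setT ->
  (forall E, G E -> P (D `&` f @^-1` E) = (c * m E)%E) ->
  forall E, measurable E -> P (D `&` f @^-1` E) = (c * m E)%E.
Proof.
move=> mD mf c0 cfin mG IG GT H E mE.
pose m0 : {measure set T' -> \bar R} := pushforward (mrestr P mD) f.
pose m1 := m0 mf.
pose m2 : {measure set T' -> \bar R} := mscale (NngNum (fine_ge0 c0)) m.
have m2E A : m2 A = (c * m A)%E.
  by rewrite [LHS](_ : _ = ((fine c)%:E * m A)%E)// fineK.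
have m1E A : m1 A = P (D `&` f @^-1` A).
  by rewrite setIC.
rewrite -m1E -m2E; apply: (@measure_unique _ R T' G (fun=> setT)) => //.
- by rewrite bigcup_const//; exists 0%N.
- by move=> A GA; rewrite [LHS]m1E [RHS]m2E; exact: H.
- move=> _; rewrite [X in (X < _)%E]m1E; apply: le_lt_trans (ltry 1).
  by apply: probability_le1; rewrite preimage_setT setIT.
Qed.

(** * The measurable space of jump data, generated by finite cylinders *)

Section sequence_space.
Context {R : realType}.

Definition cylinder n (B C : nat -> set R) : set ((nat -> R) * (nat -> R)) :=
  [set u | forall i, (i < n)%N -> B i (u.1 i) /\ C i (u.2 i)].

Definition cylinders : set (set ((nat -> R) * (nat -> R))) :=
  [set E | exists n B C, [/\ forall i, measurable (B i),
     forall i, measurable (C i) & E = cylinder n B C]].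

Definition seqsType := g_sigma_algebraType cylinders.

Lemma setI_closed_cylinders : setI_closed cylinders.
Proof.
move=> _ _ [n [B [C [mB mC ->]]]] [n' [B' [C' [mB' mC' ->]]]].
(* Beyond its own length a cylinder imposes nothing, so its sets are replaced by [setT] up to the
   common length. *)
pose cut m (X : nat -> set R) i := if (i < m)%N then X i else setT.
have mcut m X : (forall i, measurable (X i)) -> forall i, measurable (cut m X i).
  by move=> mX i; rewrite /cut; case: ifP.
exists (maxn n n'), (fun i => cut n B i `&` cut n' B' i),
  (fun i => cut n C i `&` cut n' C' i); split.
- by move=> i; apply: measurableI; exact: mcut.
- by move=> i; apply: measurableI; exact: mcut.
apply/seteqP; split=> [u [H1 H2] i _|u H].
  rewrite /cut; do 2 case: ifPn; do ?split => //; by [apply H1|apply H2].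
split=> i ni; have := H i; rewrite leq_max ni ?orbT /cut ni.
  by case=> // -[? _] [? _].
by case=> // -[_ ?] [_ ?].
Qed.

Lemma cylinders_setT : cylinders setT.
Proof.
exists 0%N, (fun=> setT), (fun=> setT); split => //.
by apply/seteqP; split.
Qed.

Lemma measurable_spacing i : measurable_fun setT (fun u : seqsType => u.1 i).
Proof.
move=> _ A mA; rewrite setTI; apply: sub_sigma_algebra.
exists i.+1, (fun j => if j == i then A else setT), (fun=> setT); split => //.
  by move=> j; case: ifP.
apply/seteqP; split=> [u Au j _|u]; first by case: eqP => [->|].
by move=> /(_ i (ltnSn i)) []; rewrite eqxx.
Qed.

Lemma measurable_factor i : measurable_fun setT (fun u : seqsType => u.2 i).
Proof.
move=> _ A mA; rewrite setTI; apply: sub_sigma_algebra.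
exists i.+1, (fun=> setT), (fun j => if j == i then A else setT); split => //.
  by move=> j; case: ifP.
apply/seteqP; split=> [u Au j _|u]; first by case: eqP => [->|].
by move=> /(_ i (ltnSn i)) []; rewrite eqxx.
Qed.

Lemma measurable_position v i :
  measurable_fun setT (fun p : R * seqsType => position v p.1 p.2 i).
Proof.
elim: i => [|i IH] /=; first exact: measurable_fst.
apply: measurable_funM.
  exact: (measurableT_comp (measurable_factor i) measurable_snd).
apply: measurable_funB => //; apply: measurable_funM => //.
exact: (measurableT_comp (measurable_spacing i) measurable_snd).
Qed.

Lemma measurable_escape v : measurable (escape v : set (R * seqsType)).
Proof.
have mge (n : nat) (g : R * seqsType -> R) :
    measurable_fun setT g -> measurable [set p | n%:R <= g p].
  move=> mg.
  have -> : [set p | n%:R <= g p] = setT `&` g @^-1` `[n%:R, +oo[%classic.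
    by apply/seteqP; split=> p /=; rewrite in_itv/= andbT => // -[].
  exact: mg.
have mtau i : measurable_fun setT (fun p : R * seqsType => p.2.1 i).
  exact: (measurableT_comp (measurable_spacing i) measurable_snd).
have -> : (escape v : set (R * seqsType)) =
  (\bigcap_n \bigcup_N \bigcap_(i in [set i | (N <= i)%N])
    [set p : R * seqsType | n%:R <= position v p.1 p.2 i - v * p.2.1 i]) `&`
  (\bigcap_n \bigcup_i [set p : R * seqsType | n%:R <= \sum_(j < i) p.2.1 j]).
  apply/seteqP; split=> p [H1 H2]; split => n.
  - by move=> _; have [N HN] := H1 n; exists N.
  - by move=> _; have [N HN] := H2 n; exists N.
  - by have [N _ HN] := H1 n I; exists N.
  - by have [N _ HN] := H2 n I; exists N.
apply: measurableI; apply: bigcapT_measurable => n;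
    apply: bigcupT_measurable => N.
  apply: bigcap_measurable; first by exists N => /=.
  move=> i _; apply: mge; apply: measurable_funB; first exact: measurable_position.
  exact: measurable_funM.
by apply: mge; apply: measurable_sum => i; exact: mtau.
Qed.

End sequence_space.
Arguments seqsType : clear implicits.

(** * Decomposition of the law at the first jump; [cylinder_law] encodes independence and the
    marginal laws *)

Section renewal.
Context d (T : measurableType d) (R : realType) (P : probability T R).
Variables (tau alpha : nat -> T -> R) (nu mu : probability R R).
Hypothesis mtau : forall i, measurable_fun setT (tau i).
Hypothesis malpha : forall i, measurable_fun setT (alpha i).

Definition seqs_of (w : T) : seqsType R := (tau^~ w, alpha^~ w).

Hypothesis cylinder_law : forall n B C,
  (forall i, measurable (B i)) -> (forall i, measurable (C i)) ->
  P (seqs_of @^-1` cylinder n B C) =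
  (\prod_(i < n) nu (B i) * \prod_(i < n) mu (C i))%E.

Lemma measurable_seqs (f : T -> seqsType R) :
  (forall i, measurable_fun setT (fun w => (f w).1 i)) ->
  (forall i, measurable_fun setT (fun w => (f w).2 i)) ->
  measurable_fun setT f.
Proof.
move=> m1 m2; apply: (@measurability _ _ T (seqsType R) setT f (@cylinders R)) => //.
move=> _ [_ [n [B [C [mB mC ->]]]] <-].
rewrite setTI (_ : f @^-1` _ = \bigcap_(i in [set i | (i < n)%N])
    ((fun w => (f w).1 i) @^-1` B i `&` (fun w => (f w).2 i) @^-1` C i)); last first.
  by apply/seteqP; split=> w H i /=; exact: H.
apply: bigcap_measurableType => i _.
apply: measurableI; rewrite -[X in measurable X]setTI.
  exact: m1.
exact: m2.
Qed.

Lemma measurable_seqs_of : measurable_fun setT seqs_of.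
Proof. by apply: measurable_seqs => i /=. Qed.

Let shifted (w : T) : seqsType R := shift_seqs (seqs_of w).

Let mshifted : measurable_fun setT shifted.
Proof. by apply: measurable_seqs => i /=. Qed.

Let Q : probability (seqsType R) R :=
  distribution P (mfun_Sub (mem_set measurable_seqs_of)).

Let QE E : Q E = P (seqs_of @^-1` E). Proof. by []. Qed.

Let mpre (f : T -> R) A : measurable_fun setT f -> measurable A -> measurable (f @^-1` A).
Proof. by move=> mf mA; rewrite -[X in measurable X]setTI; exact: mf. Qed.

Let fin_numP (m : probability R R) A : measurable A -> m A \is a fin_num.
Proof. by move=> mA; exact: fin_num_measure. Qed.

(** The tail is independent of the first spacing and factor and has the law [Q] of the whole data:
    putting [A] and [B] in front of a cylinder of length [n] gives one of length [n.+1], whose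
    probability splits off [nu A * mu B]. *)
Let law1 A B E : measurable A -> measurable B -> measurable E ->
  P ((tau 0%N @^-1` A `&` alpha 0%N @^-1` B) `&` shifted @^-1` E) =
  (nu A * mu B * Q E)%E.
Proof.
move=> mA mB mE.
apply: (@scaled_law_unique _ _ T (seqsType R) R P Q _ _ _ (@cylinders R)) => //.
- by apply: measurableI; exact: mpre.
- by rewrite mule_ge0.
- by rewrite fin_numM// fin_numP.
- exact: setI_closed_cylinders.
- exact: cylinders_setT.
move=> _ [n [B' [C' [mB' mC' ->]]]].
pose cons (X : set R) (Y : nat -> set R) i := if i is j.+1 then Y j else X.
have mcons X Y : measurable X -> (forall i, measurable (Y i)) ->
    forall i, measurable (cons X Y i).
  by move=> mX mY [|i]; [exact: mX|exact: mY].
rewrite [X in (_ * X)%E](QE (cylinder n B' C')) cylinder_law// (_ : _ `&` _ =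
  seqs_of @^-1` cylinder n.+1 (cons A B') (cons B C')); last first.
  apply/seteqP; split=> [w [[Aw Bw] H] [|i]//= ni|w H].
    exact: (H i ni).
  split; first exact: (H 0%N isT).
  by move=> i ni; exact: (H i.+1 ni).
rewrite cylinder_law; [|exact: mcons|exact: mcons].
rewrite !big_ord_recl /=.
by rewrite -!muleA; congr *%E; rewrite muleCA.
Qed.

(** Rectangles generate the product sigma-algebra, which carries [law1] over to all sets of pairs
    (first factor, tail). *)
Let law2 A E : measurable A -> measurable E ->
  P (tau 0%N @^-1` A `&` (fun w => (alpha 0%N w, shifted w)) @^-1` E) =
  (nu A * (mu \x Q) E)%E.
Proof.
move=> mA mE.
apply: (scaled_law_unique _ _ _ _ _ _ _ _ mE).
- exact: mpre.
- exact: measurable_fun_pair.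
- by [].
- exact: fin_numP.
- exact: measurable_prod_measurableType.
- move=> _ _ [A1 mA1 [B1 mB1 <-]] [A2 mA2 [B2 mB2 <-]].
  exists (A1 `&` A2); first exact: measurableI.
  by exists (B1 `&` B2); [exact: measurableI|rewrite setXI].
- by exists setT => //; exists setT => //; rewrite setXTT.
move=> _ [B mB [F mF <-]].
rewrite [X in (_ * X)%E]product_measure1E// muleA -law1//.
by congr (P _); apply/seteqP; split=> w /=; [move=> [? []]|move=> [[]]].
Qed.

Let mfirst : measurable_fun setT (fun w => (alpha 0%N w, shifted w)).
Proof. exact: measurable_fun_pair. Qed.

Let M : probability (R * seqsType R)%type R :=
  distribution P (mfun_Sub (mem_set mfirst)).

Let ME E : measurable E -> M E = (mu \x Q)%E E.
Proof.
move=> mE; have := law2 (@measurableT _ R) mE.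
by rewrite preimage_setT setTI probability_setT mul1e.
Qed.

(** The first spacing is paired last, so that the nesting of the products matches the iterated
    integral in the renewal equation. *)
Let law3 E : measurable E ->
  P ((fun w => (tau 0%N w, (alpha 0%N w, shifted w))) @^-1` E) = (nu \x M)%E E.
Proof.
move=> mE; rewrite -[RHS]mul1e -[X in P X]setTI.
apply: (scaled_law_unique _ _ _ _ _ _ _ _ mE).
- by [].
- exact: measurable_fun_pair.
- by [].
- by [].
- exact: measurable_prod_measurableType.
- move=> _ _ [A1 mA1 [B1 mB1 <-]] [A2 mA2 [B2 mB2 <-]].
  exists (A1 `&` A2); first exact: measurableI.
  by exists (B1 `&` B2); [exact: measurableI|rewrite setXI].
- by exists setT => //; exists setT => //; rewrite setXTT.
move=> _ [B mB [F mF <-]].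
rewrite [X in (_ * X)%E]product_measure1E// mul1e setTI.
transitivity (nu B * M F)%E => //.
rewrite ME// -law2//.
Qed.

Definition escape_prob v x : \bar R := P [set w | escape v (x, seqs_of w)].

(** The value at [x] is the [Q]-measure of the section at [x] of a jointly measurable set. *)
Lemma measurable_escape_prob v : measurable_fun setT (escape_prob v).
Proof.
have -> : escape_prob v = Q \o xsection (escape v).
  apply/funext => x /=; rewrite QE /escape_prob; congr (P _).
  by apply/seteqP; split => w /=; rewrite /xsection/= inE.
by apply: measurable_fun_xsection; exact: measurable_escape.
Qed.

Lemma escape_prob_renewal v x :
  escape_prob v x = (\int[nu]_a \int[mu]_b escape_prob v (b * (x - v * a)))%E.
Proof.
pose E : set (R * (R * seqsType R)) :=
  (fun p => (p.2.1 * (x - v * p.1), p.2.2)) @^-1` escape v.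
have mE : measurable E.
  rewrite -[E]setTI.
  apply: (_ : measurable_fun setT (fun p : R * (R * seqsType R) =>
      (p.2.1 * (x - v * p.1), p.2.2))) => //; last exact: measurable_escape.
  apply: measurable_fun_pair.
    apply: measurable_funM.
      exact: (measurableT_comp measurable_fst measurable_snd).
    by apply: measurable_funB => //; apply: measurable_funM => //; exact: measurable_fst.
  exact: (measurableT_comp measurable_snd measurable_snd).
transitivity ((nu \x M)%E E).
  rewrite -law3//; congr (P _); apply/seteqP; split=> w /=.
    by move/escape_shift.
  by move=> H; apply/escape_shift.
(* A product measure is the integral of the measures of sections; unfolding this twice gives the
   iterated integral. *)
apply: eq_integral => a _; rewrite [LHS]ME; last exact: measurable_xsection.
apply: eq_integral => b _ /=.
rewrite QE /escape_prob; congr (P _).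
apply/seteqP; split=> w; first by move=> /set_mem/set_mem.
by move=> H; apply/mem_set/mem_set.
Qed.

End renewal.

(** * The exponential law *)

Section exponential_law.
Context {R : realType}.
Variables (lambda : R) (nu : probability R R).
Hypothesis lambda_gt0 : 0 < lambda.
Hypothesis nuE : forall A, measurable A -> nu A = exponential_prob lambda A.

Lemma exponential_le0 : nu `]-oo, 0]%classic = 0%E.
Proof.
rewrite nuE// /exponential_prob.
have m0 : lebesgue_measure [set (0 : R)] = 0%E by exact: lebesgue_measure_set1.
(* The density vanishes only for negative arguments, so the null set {0} is removed first. *)
rewrite (@ge0_negligible_integral _ _ _ _ _ ([set 0] : set (measurableTypeR R)))//=; last 2 first.
  by apply: measurable_funTS; apply/measurable_EFinP; exact: measurable_exponential_pdf.
  by move=> x _; rewrite lee_fin exponential_pdf_ge0// ltW.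
apply: integral0_eq => x [/=]; rewrite in_itv/= => x0 xN0.
rewrite /exponential_pdf patchE ifF//; apply/negbTE/negP.
rewrite inE /= in_itv/= andbT => x0'.
by apply: xN0; apply/eqP; rewrite eq_le x0 x0'.
Qed.

Lemma exponential_tail t : 0 <= t ->
  nu `]t, +oo[%classic = (expR (- (lambda * t)))%:E.
Proof.
have nu_gt0 : nu `]0, +oo[%classic = 1%E.
  have := @probability_setC _ _ _ nu `]-oo, 0]%classic (measurable_itv _).
  by rewrite exponential_le0 setCitvl sube0.
rewrite le_eqVlt => /predU1P[<-|t0]; first by rewrite mulr0 oppr0 expR0.
have -> : `]t, +oo[%classic = ~` (`]-oo, t]%classic : set R) by rewrite setCitvl.
rewrite probability_setC//.
have -> : nu `]-oo, t]%classic = (1 - expR (- (lambda * t)))%:E.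
  have := exponential_prob_itv0c lambda t0.
  rewrite -nuE// mulNr -EFinB => <-.
  apply/eqP; rewrite eq_le; apply/andP; split; last first.
    apply: le_measure; rewrite ?inE//.
    by move=> x /=; rewrite !in_itv/= => /andP[].
  rewrite -[leRHS]add0e -exponential_le0.
  apply: le_trans (measureU2 _ _ _) => //.
  apply: le_measure; rewrite ?inE//; first exact: measurableU.
  move=> x /=; rewrite !in_itv/= => ->.
  by case: (leP x 0) => [|/ltW ->]; [left|right].
by rewrite -EFinB; congr EFin; ring.
Qed.

Lemma exponential_itv0c h : 0 <= h ->
  nu `]0, h]%classic = (1 - expR (- (lambda * h)))%:E.
Proof.
move=> h0; have e1 : nu `]0, +oo[%classic = 1%E.
  by rewrite exponential_tail// mulr0 oppr0 expR0.
have -> : `]0, h]%classic = `]0, +oo[%classic `\` (`]h, +oo[%classic : set R).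
  apply/seteqP; split=> x /=; rewrite !in_itv/= !andbT.
    by move=> /andP[-> xh]; split => //; apply/negP; rewrite -leNgt.
  by move=> [-> /negP]; rewrite -leNgt.
rewrite measureD//=; last by rewrite e1 ltry.
rewrite setIidr; last first.
  move=> x /=; rewrite !in_itv/= !andbT; exact: le_lt_trans.
by rewrite e1 exponential_tail.
Qed.

(** The half-lines []x, +oo[] together with [setT] form a generating pi-system, and on them the
    claim is the multiplicativity of exponential tails. *)
Lemma exponential_memoryless h (A : set R) : 0 <= h -> measurable A ->
  nu (`]h, +oo[%classic `&` (fun a => a - h) @^-1` A) =
  ((expR (- (lambda * h)))%:E * nu A)%E.
Proof.
move=> h0 mA.
pose G := [set B | B = setT \/ exists x : R, B = `]x, +oo[%classic].
apply: (@scaled_law_unique _ _ R R R nu nu _ _ _ G) => //.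
- exact: measurable_funB.
- rewrite [LHS]RGenOInfty.measurableE; apply/seteqP; split.
    apply: smallest_sub; first exact: smallest_sigma_algebra.
    by move=> _ [x ->]; apply: sub_sigma_algebra; right; exists x.
  apply: smallest_sub; first exact: smallest_sigma_algebra.
  move=> _ [->|[x ->]]; last by apply: sub_sigma_algebra; exists x.
  exact: (@measurableT _ (g_sigma_algebraType (@RGenOInfty.G R))).
- move=> _ _ [->|[x ->]] [->|[y ->]]; rewrite ?setTI ?setIT; [by left| | |].
  + by right; exists y.
  + by right; exists x.
  + right; exists (Num.max x y); apply/seteqP; split=> z /=.
      by rewrite !in_itv/= !andbT gt_max => -[-> ->].
    by rewrite !in_itv/= !andbT gt_max => /andP[].
- by left.
move=> _ [->|[x ->]].
  rewrite preimage_setT setIT exponential_tail//.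
  by rewrite [X in (_ * X)%E](probability_setT nu) mule1.
have [x0|/ltW x0] := leP 0 x.
  rewrite (_ : _ `&` _ = `](x + h), +oo[%classic); last first.
    apply/seteqP; split=> z /=; rewrite !in_itv/= !andbT ltrBrDr; first by case.
    by move=> xhz; split => //; apply: le_lt_trans xhz; rewrite lerDr.
  rewrite [X in (_ * X)%E](exponential_tail x0) exponential_tail ?addr_ge0//.
  rewrite -EFinM -expRD.
  by congr (expR _)%:E; ring.
(* For negative [x] the shifted half-line contains []h, +oo[], while []x, +oo[] has full mass. *)
rewrite (_ : _ `&` _ = `]h, +oo[%classic); last first.
  apply/seteqP; split=> z /=; rewrite !in_itv/= !andbT ltrBrDr; first by case.
  by move=> hz; split => //; apply: le_lt_trans hz; rewrite gerDr.
rewrite exponential_tail//.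
suff nux : nu `]x, +oo[%classic = 1%E by rewrite [X in (_ * X)%E]nux mule1.
apply/eqP; rewrite eq_le probability_le1//=.
have <- : nu `]0, +oo[%classic = 1%E.
  by rewrite exponential_tail// mulr0 oppr0 expR0.
apply: le_measure; rewrite ?inE//.
by move=> z /=; rewrite !in_itv/= !andbT; exact: le_lt_trans.
Qed.

Lemma exponential_integral_gt0 (phi : R -> \bar R) :
  measurable_fun setT phi -> (forall a, (0 <= phi a)%E) ->
  (\int[nu]_a phi a = \int[nu]_(a in `]0%R, +oo[) phi a)%E.
Proof.
move=> mphi phi0.
rewrite (@ge0_negligible_integral _ R R nu setT (`]-oo, 0%R]%classic : set R))//=; last first.
  exact: exponential_le0.
by rewrite setTD setCitvl.
Qed.

(** Pushing [nu] forward by the shift turns the integral into one over []0, +oo[], where the new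
    measure is a multiple of [nu] by memorylessness. *)
Lemma exponential_integral_memoryless h (phi : R -> \bar R) :
  0 <= h -> measurable_fun setT phi -> (forall a, (0 <= phi a)%E) ->
  (\int[nu]_(a in `]h, +oo[) phi (a - h)%R =
   (expR (- (lambda * h)))%:E * \int[nu]_a phi a)%E.
Proof.
move=> h0 mphi phi0.
have mshift : measurable_fun [set: R] (fun a => a - h) by exact: measurable_funB.
have -> : `]h, +oo[%classic = (fun a => a - h) @^-1` `]0, +oo[%classic.
  by apply/seteqP; split=> z /=; rewrite !in_itv/= !andbT subr_gt0.
rewrite -[LHS](ge0_integral_pushforward mshift nu)//; last first.
  exact: measurable_funTS.
have c0 := expR_ge0 (- (lambda * h)).
rewrite exponential_integral_gt0//.
rewrite -(@ge0_integral_mscale _ _ _ nu _ (measurable_itv _) (NngNum c0))//; last first.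
  exact: measurable_funTS.
apply: eq_measure_integral => A mA A0.
rewrite [RHS](_ : _ = ((expR (- (lambda * h)))%:E * nu A)%E)//.
rewrite -exponential_memoryless// /pushforward; congr (nu _).
apply/seteqP; split=> z /=; last by case.
by move=> zA; split=> //; have := A0 _ zA; rewrite /= !in_itv/= !andbT subr_gt0.
Qed.

(* The renewal equation at [x + v h], split according to whether the first
   jump occurs before or after the time [h]. *)
Lemma exponential_renewal_bounds (v h x : R) (p q : R -> \bar R) :
  0 < v -> 0 <= h -> measurable_fun setT q -> (forall y, (0 <= q y)%E) ->
  {homo q : y z / y <= z >-> (y <= z)%E} ->
  (forall y, p y = \int[nu]_a q (y - v * a)%R)%E ->
  (q x * (1 - expR (- (lambda * h)))%:E +
     (expR (- (lambda * h)))%:E * p x <= p (x + v * h)%R <=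
   q (x + v * h)%R * (1 - expR (- (lambda * h)))%:E +
     (expR (- (lambda * h)))%:E * p x)%E.
Proof.
move=> v0 h0 mq q0 qmono pE.
have mqx y : measurable_fun [set: R] (fun a => q (y - v * a)).
  apply: measurableT_comp => //.
  by apply: measurable_funB => //; apply: measurable_funM.
(* If the first jump comes after [h], the drift up to time [h] leads from [x + v * h] to [x], and by
   memorylessness the process starts afresh there. *)
have -> : p (x + v * h) = (\int[nu]_(a in `]0%R, h]) q (x + v * h - v * a)%R +
    (expR (- (lambda * h)))%:E * p x)%E.
  rewrite pE exponential_integral_gt0//.
  have -> : `]0, +oo[%classic = `]0, h]%classic `|` (`]h, +oo[%classic : set R).
    apply/seteqP; split=> z /=; rewrite !in_itv/= !andbT.
      by move=> ->; case: (leP z h); [left|right].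
    by move=> [/andP[]//|]; exact: le_lt_trans.
  rewrite ge0_integral_setU//; last 2 first.
    exact: measurable_funTS.
    apply/disj_set2P; apply/seteqP; split=> z //=; rewrite !in_itv/= andbT.
    by move=> [/andP[_ zh] /lt_le_trans /(_ zh)]; rewrite ltxx.
  congr (_ + _)%E.
  rewrite pE -(exponential_integral_memoryless (phi := fun a => q (x - v * a)))//.
  by apply: eq_integral => a _; congr (q _); ring.
have mitv : measurable (`]0, h]%classic : set R) by [].
have qint c : (\int[nu]_(a in `]0%R, h]) cst c a =
    c * (1 - expR (- (lambda * h)))%:E)%E.
  by rewrite integral_cst//; congr (_ * _)%E; exact: exponential_itv0c.
have mq' := measurable_funTS (D := `]0, h]%classic) (mqx (x + v * h)).
(* For [0 < a <= h] the argument of [q] lies between [x] and [x + v * h]. *)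
apply/andP; split; rewrite leeD2r// -qint; apply: ge0_le_integral => //=.
- move=> a /=; rewrite in_itv/= => /andP[a0 ah]; apply: qmono.
  by rewrite -addrA lerDl subr_ge0 ler_pM2l.
- move=> a /=; rewrite in_itv/= => /andP[a0 ah]; apply: qmono.
  by rewrite lerBlDr lerDl mulr_ge0// ltW.
Qed.

End exponential_law.

(** * Means of rescaled functions *)

Section scaled_mean.
Context {R : realType}.
Variable mu : probability R R.

(** The weight [b ^+ j] is what [j] differentiations of [g (b * x)] in [x] produce. *)
Definition scaled_mean (j : nat) (g : R -> R) (x : R) : R :=
  \int[mu]_(b in `]0, +oo[) (b ^+ j * g (b * x)).

Definition finite_moment (j : nat) : Prop :=
  (\int[mu]_(b in `]0%R, +oo[) (b ^+ j)%:E < +oo)%E.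

Let pos : set R := `]0, +oo[%classic.
Let mpos : measurable pos. Proof. exact: measurable_itv. Qed.

(** For positive [b] one has [b ^+ i <= 1 + b ^+ j], and [mu] is finite. *)
Lemma finite_moment_le i j : (i <= j)%N -> finite_moment j -> finite_moment i.
Proof.
move=> ij mj; rewrite /finite_moment.
have ge0 k (b : R) : pos b -> (0%R <= (b ^+ k)%:E)%E.
  by rewrite /pos /= in_itv/= andbT => b0; rewrite lee_fin exprn_ge0 ?ltW.
have mX k : measurable_fun pos (fun b : R => (b ^+ k)%:E).
  by apply/measurable_EFinP; apply: measurable_funX.
apply: (@le_lt_trans _ _ (\int[mu]_(b in pos) (1 + (b ^+ j)%:E))%E).
  apply: ge0_le_integral => //=; [exact: ge0|exact: emeasurable_funD|].
  move=> b; rewrite in_itv/= andbT => b0; rewrite -EFinD lee_fin.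
  have [b1|/ltW b1] := leP b 1.
    apply: (@le_trans _ _ (1 : R)); first exact: (exprn_ile1 _ (ltW b0) b1).
    by rewrite lerDl; exact: (exprn_ge0 _ (ltW b0)).
  by rewrite (@le_trans _ _ (b ^+ j))// ?ler_weXn2l// lerDr.
rewrite (ge0_integralD _ mpos _ _ (ge0 j))//.
rewrite integral_cst// mul1e lte_add_pinfty//.
by apply: le_lt_trans (ltry 1); exact: probability_le1.
Qed.

Lemma integrable_moment j : finite_moment j ->
  mu.-integrable pos (fun b => (b ^+ j)%:E).
Proof.
move=> mj; apply/integrableP; split.
  by apply/measurable_EFinP; apply: measurable_funX.
rewrite (_ : (\int[_]_(_ in _) _)%E = (\int[mu]_(b in pos) (b ^+ j)%:E)%E)//.
apply: eq_integral => b; rewrite inE /pos /= in_itv/= andbT => b0.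
by rewrite ger0_norm// exprn_ge0 ?ltW.
Qed.

Lemma integrable_scaled (j : nat) (g : R -> R) (C x : R) :
  finite_moment j -> measurable_fun setT g -> (forall y, `|g y| <= C) ->
  mu.-integrable pos (EFin \o (fun b => b ^+ j * g (b * x))).
Proof.
move=> mj mg gC.
apply: (@le_integrable _ _ _ mu pos mpos _ (fun b => C%:E * (b ^+ j)%:E)%E).
- apply/measurable_EFinP; apply: measurable_funTS; apply: measurable_funM.
    exact: measurable_funX.
  by apply: measurableT_comp => //; apply: measurable_funM.
- move=> b; rewrite /pos /= in_itv/= andbT => b0; rewrite lee_fin.
  rewrite !normrM [leRHS]mulrC ler_wpM2l//.
  by rewrite (le_trans (gC _))// ler_norm.
- by apply: integrableZl => //; exact: integrable_moment.
Qed.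

Lemma scaled_mean_bounded (j : nat) (g : R -> R) (C : R) :
  finite_moment j -> measurable_fun setT g -> (forall y, `|g y| <= C) ->
  exists C', forall x, `|scaled_mean j g x| <= C'.
Proof.
move=> mj mg gC; exists (\int[mu]_(b in pos) (C * b ^+ j)) => x.
have ig := integrable_scaled x mj mg gC.
have iC : mu.-integrable pos (EFin \o (fun b => C * b ^+ j)).
  by have := integrableZl mpos C (integrable_moment mj).
apply: le_trans (le_normr_Rintegral _ _) _ => //.
apply: le_Rintegral => //.
  exact: (integrable_norm ig).
move=> b; rewrite /pos /= in_itv/= andbT => b0.
rewrite normrM mulrC (ger0_norm (exprn_ge0 _ (ltW b0))).
by rewrite ler_wpM2r// exprn_ge0// ltW.
Qed.

(** Dominated convergence with the majorant [C * b ^+ j]. *)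
Lemma continuous_scaled_mean (j : nat) (g : R -> R) (C : R) :
  finite_moment j -> continuous g -> (forall y, `|g y| <= C) ->
  continuous (scaled_mean j g).
Proof.
move=> mj cg gC x.
have mg : measurable_fun setT g by exact: continuous_measurable_fun.
have cb (b : R) : continuous (fun x : R => b ^+ j * g (b * x)).
  move=> y; apply: cvgM; first exact: cvg_cst.
  apply: (@continuous_comp _ _ _ (fun x : R => b * x) g).
    exact: mulrl_continuous.
  exact: cg.
have x1 : x \in (`]x - 1, x + 1[%classic : set R).
  by rewrite inE /= in_itv/= ltrDl gtrBl ltr01.
apply: (@continuity_under_integral _ _ _ mu (fun x b => b ^+ j * g (b * x)) pos mpos
  (x - 1) (x + 1) _ _ (fun b => C * b ^+ j) _ _ x x1).
- by move=> y _; exact: (integrable_scaled y mj mg gC).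
- by apply: aeW => b _ y _; exact: cb.
- by have := integrableZl mpos C (integrable_moment mj).
- move=> y _; apply: aeW => b; rewrite /pos /= in_itv/= andbT => b0.
  rewrite normrM mulrC (ger0_norm (exprn_ge0 _ (ltW b0))).
  by rewrite ler_wpM2r// exprn_ge0// ltW.
Qed.

(** Differentiating [g (b * x)] brings out one more factor [b], so the majorant of the derivative
    costs one more moment. *)
Lemma is_derive_scaled_mean (j : nat) (g g' : R -> R) (C C' : R) :
  finite_moment j.+1 -> (forall x : R, is_derive x 1 g (g' x)) ->
  (forall y, `|g y| <= C) -> (forall y, `|g' y| <= C') ->
  forall x : R, is_derive x 1 (scaled_mean j g) (scaled_mean j.+1 g' x).
Proof.
move=> mj1 dg gC gC' x.
have mj : finite_moment j by apply: finite_moment_le mj1.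
have cg : continuous g.
  move=> y; apply: differentiable_continuous; apply/derivable1_diffP.
  by case: (dg y).
have mg : measurable_fun setT g by exact: continuous_measurable_fun.
have x1 : (`]x - 1, x + 1[%classic : set R) x.
  by rewrite /= in_itv/= ltrDl gtrBl ltr01.
have dint y b : is_derive y (1 : R) (fun x => b ^+ j * g (b * x))
    (b ^+ j.+1 * g' (b * y)).
  have db : is_derive y (1 : R) (fun x => b * x) b.
    by apply: is_derive_eq; rewrite /GRing.scale /= mulr1.
  have := is_deriveZ (b ^+ j) (is_derive1_comp (dg (b * y)) db).
  move=> /is_derive_eq; apply.
  by rewrite /GRing.scale /= exprS; ring.
have d1E y b : partial1of2 (fun x b => b ^+ j * g (b * x)) y b =
    b ^+ j.+1 * g' (b * y).
  by rewrite partial1of2E; apply: derive_val.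
(* The majorant must be nonnegative on the whole line, hence the absolute values. *)
have := @cvg_differentiation_under_integral _ _ _ mu
  (fun x b => b ^+ j * g (b * x)) pos mpos x (x - 1) (x + 1) x1 _ _
  (fun b => `|C'| * `|b| ^+ j.+1).
move=> H.
suff H0 : h^-1 *: (scaled_mean j g (h + x) - scaled_mean j g x) @[h --> 0^'] -->
    scaled_mean j.+1 g' x.
  have H1 : (fun h => h^-1 *: (scaled_mean j g (h *: 1 + x) - scaled_mean j g x)) @ 0^'
      --> scaled_mean j.+1 g' x.
    by under eq_fun do rewrite [_ *: 1]mulr1; exact: H0.
  apply: DeriveDef; first by apply/cvg_ex; exists (scaled_mean j.+1 g' x).
  by apply/cvg_lim.
rewrite [X in _ --> X](_ : _ = \int[mu]_(b in pos)
    partial1of2 (fun x b => b ^+ j * g (b * x)) x b); last first.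
  by apply: eq_Rintegral => b _; rewrite d1E.
apply: H.
- by move=> y _; exact: (integrable_scaled y mj mg gC).
- by move=> y b _ _; case: (dint y b).
- by move=> b; rewrite mulr_ge0// exprn_ge0.
- apply: (eq_integrable mpos (fun b => (`|C'|)%:E * (b ^+ j.+1)%:E)%E).
    move=> b; rewrite inE /pos /= in_itv/= andbT => b0.
    by rewrite /= (ger0_norm (ltW b0)).
  by apply: integrableZl => //; exact: integrable_moment.
- move=> y b _ _; rewrite d1E normrM mulrC normrX ler_wpM2r ?exprn_ge0//.
  by rewrite (le_trans (gC' _))// ler_norm.
Qed.

End scaled_mean.

(** * Regularity and derivatives at zero *)

Section vanishing_derivatives.
Context {R : realType}.
Implicit Type f : R -> R.

Lemma derive1_eq0_left f : (forall x : R, x <= 0 -> f x = 0) ->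
  forall x : R, x <= 0 -> derive1 f x = 0.
Proof.
move=> f0 x x0; rewrite /derive1.
set q := fun h : R => _.
(* A divergent difference quotient gets the default limit 0; a convergent one has the limit of its
   left restriction, which is identically 0. *)
have [cq|ncq] := pselect (cvg (q h @[h --> 0^'])); last first.
  by rewrite (dvgP ncq).
have ql : q h @[h --> 0^'-] --> lim (q h @[h --> 0^']).
  apply: cvg_trans cq; apply: cvg_app; apply: within_subset => y /=.
  by move=> /= y0; rewrite lt_eqF.
have q0 : \forall h \near 0^'-, cst (0 : R) h = q h.
  near=> h.
  have h0 : h < 0 by near: h; exact: nbhs_left_lt.
  have hx : h + x <= 0 by lra.
  by rewrite /q (f0 _ hx) (f0 _ x0) subr0 scaler0.
apply: (cvg_unique _ ql) => //.
exact: cvg_trans (near_eq_cvg q0) (cvg_cst (0 : R)).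
Unshelve. all: by end_near. Qed.

Lemma derive1n_eq0_left f : (forall x : R, x <= 0 -> f x = 0) ->
  forall k (x : R), x <= 0 -> derive1n k f x = 0.
Proof.
move=> f0; elim=> [|k IH] x x0; first exact: f0.
by rewrite derive1nS; apply: derive1_eq0_left.
Qed.

End vanishing_derivatives.

(** * From the two-sided renewal bounds to the differential equation *)

Section renewal_bounds.
Context {R : realType}.
Variables (a1 : R) (f F : R -> R).
Hypothesis a1_gt0 : 0 < a1.
Hypotheses (f_ge0 : forall x, 0 <= f x) (f_le1 : forall x, f x <= 1).
Hypotheses (F_ge0 : forall x, 0 <= F x) (F_le1 : forall x, F x <= 1).
Let e t := 1 - expR (- (t / a1)).
Hypothesis fF : forall x t, 0 <= t ->
  F x * e t + (1 - e t) * f x <= f (x + t) <= F (x + t) * e t + (1 - e t) * f x.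

(** All three bounds follow from [1 + r <= expR r] at [r = s] and [r = - s], since the two
    exponentials are inverse to each other. *)
Let e_bounds t : 0 <= t -> [/\ 0 <= e t, e t <= t / a1 & t / a1 - e t <= (t / a1) ^+ 2].
Proof.
move=> t0; rewrite /e; set s := t / a1.
have s0 : 0 <= s by rewrite divr_ge0// ltW.
have h1 : 1 + - s <= expR (- s) := expR_ge1Dx _.
have h2 : 1 + s <= expR s := expR_ge1Dx _.
have h3 : expR s * expR (- s) = 1 by rewrite -expRD subrr expR0.
have h4 : 0 < expR (- s) by exact: expR_gt0.
have h5 : (1 + s) * expR (- s) <= expR s * expR (- s) by rewrite ler_pM2r.
rewrite h3 in h5.
split; [nra|lra|nra].
Qed.

(** As [f] and [F] take values in [0, 1], both renewal bounds differ from [f x] by at most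
    [e (y - x)]. *)
Lemma renewal_lipschitz x y : `|f x - f y| <= `|x - y| / a1.
Proof.
wlog xy : x y / x <= y.
  move=> H; have [|/ltW] := leP x y; first exact: H.
  by move=> /H; rewrite distrC [X in _ <= X / _ -> _]distrC.
have t0 : 0 <= y - x by rewrite subr_ge0.
have [e0 e1 _] := e_bounds t0.
have := fF x t0; rewrite [x + _]addrC subrK => /andP[H1 H2].
rewrite distrC [X in _ <= X / _]distrC (ger0_norm t0).
have [[[? ?] ?] ?] := (f_ge0 x, f_le1 x, F_ge0 x, F_le1 y).
apply: le_trans e1; rewrite ler_norml; apply/andP; split.
all: nra.
Qed.

Lemma renewal_continuous : continuous f.
Proof.
move=> x; apply/cvgrPdist_le => eps eps0; near=> y.
apply: le_trans (renewal_lipschitz x y) _.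
rewrite ler_pdivrMr//; near: y.
by apply: cvgr_dist_le; [exact: cvg_id|exact: mulr_gt0].
Unshelve. all: by end_near. Qed.

Let increment_bound x h :
  `|(f (h + x) - f x) - h / a1 * (F x - f x)| <=
  `|h| / a1 * (`|h| / a1 + `|F (h + x) - F x| + `|f (h + x) - f x|).
Proof.
(* Replacing [et] by its linearization [s] costs at most [s ^+ 2]; [d1] and [d2] stand for the
   increments of [F] and [f]. *)
have key (D s et G d1 d2 : R) : 0 <= et -> et <= s -> s - et <= s ^+ 2 ->
    `|G| <= 1 -> `|D - et * G| <= et * (d1 + d2) -> 0 <= d1 -> 0 <= d2 ->
    `|D - s * G| <= s * (s + d1 + d2).
  move=> e0 es se G1 DG d10 d20.
  have -> : D - s * G = (D - et * G) - (s - et) * G by ring.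
  apply: le_trans (ler_normB _ _) _; rewrite normrM (@ger0_norm _ (s - et)) ?subr_ge0//.
  have : (s - et) * `|G| <= s ^+ 2.
    by apply: le_trans se; rewrite ler_piMr// subr_ge0.
  have : et * (d1 + d2) <= s * (d1 + d2) by rewrite ler_wpM2r// addr_ge0.
  nra.
have G1 : `|F x - f x| <= 1.
  have [[[? ?] ?] ?] := (f_ge0 x, f_le1 x, F_ge0 x, F_le1 x).
  by rewrite ler_norml; apply/andP; split; lra.
have [h0|/ltW h0] := leP 0 h.
  have [e0 e1 e2] := e_bounds h0.
  rewrite (ger0_norm h0); apply: (key _ _ (e h)) => //.
  have := fF x h0; rewrite [x + h]addrC => /andP[H1 H2].
  have := ler_norm (F (h + x) - F x).
  have := normr_ge0 (f (h + x) - f x).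
  move: `|_| => d2; move: `|_| => d1 ? ?.
  by rewrite ler_norml; apply/andP; split; nra.
(* For negative [h] the renewal bounds start from [h + x] and lead up to [x]; the exchange of base
   points is paid by the increments. *)
have h0' : 0 <= - h by rewrite oppr_ge0.
have [e0 e1 e2] := e_bounds h0'.
rewrite (ler0_norm h0).
rewrite (_ : _ - _ = - ((f x - f (h + x)) - (- h) / a1 * (F x - f x))); last by ring.
rewrite normrN.
apply: (key _ _ (e (- h))) => //.
have := fF (h + x) h0'; rewrite (_ : h + x - h = x); last by ring.
move=> /andP[H1 H2].
have /ler_normlP[] := lexx `|F (h + x) - F x|.
have /ler_normlP[] := lexx `|f (h + x) - f x|.
move: `|_| => d2 ? ?; move: `|_| => d1 ? ?.
by rewrite ler_norml; apply/andP; split; nra.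
Qed.

(** Divided by [h], [increment_bound] leaves the error [b h], which tends to 0 by continuity of [F]
    and [f]. *)
Lemma renewal_is_derive : continuous F ->
  forall x : R, is_derive x 1 f ((F x - f x) / a1).
Proof.
move=> cF x.
have cf := renewal_continuous.
pose b (h : R) := (`|h| / a1 + `|F (h + x) - F x| + `|f (h + x) - f x|) / a1.
have b0 : b h @[h --> 0^'] --> (0 : R).
  have cshift (g : R -> R) : continuous g -> `|g (h + x) - g x| @[h --> (0 : R)] --> (0 : R).
    move=> cg.
    have shift0 : h + x @[h --> (0 : R)] --> x.
      have : h + x @[h --> (0 : R)] --> 0 + x.
        by apply: cvgD; [exact: cvg_id|exact: cvg_cst].
      by rewrite add0r.
    have := cvg_norm (cvgB (cvg_comp _ _ shift0 (cg x)) (cvg_cst (g x))).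
    by rewrite subrr normr0; apply.
  apply: cvg_within_filter.
  have absa1 : `|h| / a1 @[h --> (0 : R)] --> (0 : R).
    have := cvgM (cvg_norm (@cvg_id _ (nbhs (0 : R)))) (cvg_cst a1^-1).
    by rewrite normr0 mul0r; apply.
  have := cvgM (cvgD (cvgD absa1 (cshift F cF)) (cshift f cf)) (cvg_cst a1^-1).
  by rewrite !addr0 mul0r; apply.
suff H : h^-1 *: (f (h *: 1 + x) - f x) @[h --> 0^'] --> (F x - f x) / a1.
  apply: DeriveDef; first by apply/cvg_ex; exists ((F x - f x) / a1).
  exact/cvg_lim.
apply/subr_cvg0/norm_cvg0P.
apply: (squeeze_cvgr _ (cvg_cst (0 : R)) b0).
near=> h; rewrite normr_ge0/=.
have h0 : h != 0 by near: h; exact: nbhs_dnbhs_neq.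
rewrite /b.
have -> : h^-1 *: (f (h%:A + x) - f x) - (F x - f x) / a1 =
   h^-1 * ((f (h + x) - f x) - h / a1 * (F x - f x)).
  by rewrite [h%:A]mulr1 /GRing.scale /=; field; rewrite h0 gt_eqF.
rewrite normrM normfV ler_pdivrMl ?normr_gt0//.
apply: le_trans (increment_bound _ _) _.
by rewrite le_eqVlt; apply/orP; left; apply/eqP; ring.
Unshelve. all: by end_near. Qed.

End renewal_bounds.

(** * Higher derivatives from finite moments *)

Section smoothness.
Context {R : realType}.
Variables (mu : probability R R) (a1 : R) (f : R -> R).
Hypothesis f_ge0 : forall x, 0 <= f x.
Hypothesis f_le1 : forall x, f x <= 1.
Hypothesis f_derive : forall x : R, is_derive x 1 f ((scaled_mean mu 0 f x - f x) / a1).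

Let derivable_cont (g : R -> R) (dg : R -> R) :
  (forall x : R, is_derive x 1 g (dg x)) -> continuous g.
Proof.
move=> H y; apply: differentiable_continuous; apply/derivable1_diffP.
by case: (H y).
Qed.

(** The bound is carried through the induction because differentiation under the integral requires
    the derivatives of orders [j] and [j.+1] to be bounded. *)
Lemma is_derive_derive1n n : finite_moment mu n -> forall j, (j <= n)%N ->
  (exists C, forall x, `|derive1n j f x| <= C) /\
  (forall x : R, is_derive x 1 (derive1n j f)
     ((scaled_mean mu j (derive1n j f) x - derive1n j f x) / a1)).
Proof.
move=> mn; elim=> [|j IH] jn.
  split; last exact: f_derive.
  by exists 1 => x; rewrite ger0_norm.
have [[C fC] df] := IH (ltnW jn).
have mj := finite_moment_le (ltnW jn) mn.
have mj1 := finite_moment_le jn mn.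
have cf := derivable_cont df.
have mf : measurable_fun setT (derive1n j f) by exact: continuous_measurable_fun.
have fE : derive1n j.+1 f =
    fun x => (scaled_mean mu j (derive1n j f) x - derive1n j f x) / a1.
  by rewrite derive1nS; apply/funext => x; rewrite derive1E; apply: derive_val.
have [C0 C0P] := scaled_mean_bounded mj mf fC.
have bnd : exists C', forall x, `|derive1n j.+1 f x| <= C'.
  exists ((C0 + C) * `|a1^-1|) => x; rewrite fE normrM ler_wpM2r//.
  by apply: le_trans (ler_normB _ _) _; exact: lerD.
split=> // x; have [C' C'P] := bnd.
have df1 y : is_derive y (1 : R) (derive1n j f) (derive1n j.+1 f y).
  by rewrite fE.
have ds := is_derive_scaled_mean mj1 df1 fC C'P x.
rewrite [X in is_derive _ _ X _]fE.
have := is_deriveZ a1^-1 (is_deriveB ds (df1 x)).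
rewrite (_ : _ \*: _ = (fun x => (scaled_mean mu j (derive1n j f) x - derive1n j f x) / a1)).
  by move=> /is_derive_eq; apply; rewrite [RHS]mulrC.
by apply/funext => y /=; rewrite mulrC.
Qed.

(** The gain of one order comes from the equation at [j = k]: it already makes the derivative of
    order [k] differentiable. *)
Lemma times_derivable_moment k : finite_moment mu k ->
  forall x, times_derivable k.+1 f x.
Proof.
have nearA (Q : R -> Prop) (y : R) : (forall z, Q z) -> \forall z \near y, Q z.
  by move=> H; near=> z; exact: H.
move=> mk; have : (k <= k)%N by [].
elim: {-2}k => [|j IH] jk x.
  by split; [exact: nearA|case: (f_derive x)].
split; first by apply: nearA => y; exact: IH (ltnW jk) y.
by have [_ /(_ x) []] := is_derive_derive1n mk jk.
Unshelve. all: by end_near. Qed.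

End smoothness.

(** * The escape probability *)

Section jump_data.
Context d (T : measurableType d) (R : realType) (P : probability T R).
Variables (lambda v : R) (mu : probability R R).
Variables (sigma xi : nat -> {RV P >-> R}).
Hypotheses (lambda_gt0 : 0 < lambda) (v_gt0 : 0 < v).
Hypothesis sigma_poisson : poisson_arrival_times P lambda sigma.
Hypothesis xi_indep : mutually_independent P xi.
Hypothesis xi_law : forall i, has_law P (fun w => expR (xi i w)) mu.
Hypothesis sigma_xi_indep : independent_sequences P sigma xi.

Definition spacing i (w : T) : R := sigma i.+1 w - sigma i w.
Definition jump_factor i (w : T) : R := expR (xi i w).

Let mtau i : measurable_fun setT (spacing i).
Proof. exact: measurable_funB. Qed.

Let malpha i : measurable_fun setT (jump_factor i).
Proof. exact: measurableT_comp. Qed.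

Definition spacing_law : probability R R :=
  distribution P (mfun_Sub (mem_set (mtau 0%N))).

Lemma spacing_lawE A : measurable A -> spacing_law A = exponential_prob lambda A.
Proof.
by move=> mA; have [_ _ _ /(_ 0%N A mA) <-] := sigma_poisson.
Qed.

Let gen_sigma (X : nat -> T -> R) (n : nat) (g : nat -> T -> R) (B : nat -> set R) :
  (forall i A, measurable A -> generated_sigma_algebra X (g i @^-1` A)) ->
  (forall i, measurable (B i)) ->
  generated_sigma_algebra X (\bigcap_(i in [set` index_iota 0 n]) (g i @^-1` B i)).
Proof.
move=> H mB.
pose G := [set A | exists i (B : set R), measurable B /\ A = X i @^-1` B].
apply: (@bigcap_measurableType _ (g_sigma_algebraType G)) => i _.
exact: H.
Qed.

(** The event splits into one on spacings and one on exponents; independence of the two sequences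
    factors it, then independence within each sequence does. *)
Lemma cylinder_law n (B C : nat -> set R) :
  (forall i, measurable (B i)) -> (forall i, measurable (C i)) ->
  P (seqs_of spacing jump_factor @^-1` cylinder n B C) =
  (\prod_(i < n) spacing_law (B i) * \prod_(i < n) mu (C i))%E.
Proof.
move=> mB mC.
have [_ _ tau_indep tau_law] := sigma_poisson.
have mexpC i : measurable (@expR R @^-1` C i).
  by rewrite -[X in measurable X]setTI; exact: measurable_expR.
have -> : seqs_of spacing jump_factor @^-1` cylinder n B C =
  (\bigcap_(i in [set` index_iota 0 n]) (spacing i @^-1` B i)) `&`
  (\bigcap_(i in [set` index_iota 0 n]) (xi i @^-1` (@expR R @^-1` C i))).
  apply/seteqP; split=> w.
    by move=> H; split=> i /=; rewrite mem_index_iota => /= ni; have [] := H i ni.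
  by move=> [H1 H2] i ni; split; [apply: (H1 i)|apply: (H2 i)];
    rewrite /= mem_index_iota.
rewrite sigma_xi_indep; last 2 first.
- apply: gen_sigma => // i A mA.
  (* Spacings are differences of arrival times, hence measurable for the sigma-algebra these
     generate. *)
  pose G := [set A | exists i (B : set R), measurable B /\ A = sigma i @^-1` B].
  have mG k : measurable_fun (setT : set (g_sigma_algebraType G)) (sigma k).
    by move=> _ D mD; rewrite setTI; apply: sub_sigma_algebra; exists k, D.
  have := measurable_funB (mG i.+1) (mG i) measurableT mA.
  by rewrite setTI.
- apply: gen_sigma => // i A mA.
  by apply: sub_sigma_algebra; exists i, A.
rewrite tau_indep ?iota_uniq// xi_indep ?iota_uniq// !big_mkord.
congr (_ * _)%E; apply: eq_bigr => i _.
  by rewrite spacing_lawE//; exact: tau_law.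
exact: xi_law.
Qed.

Let p := escape_prob P spacing jump_factor v.

Lemma f_infty_escape_prob x : f_infty P v sigma xi x = fine (p x).
Proof.
have [s0 s_incr _ _] := sigma_poisson.
rewrite /f_infty /p /escape_prob; congr (fine (P _)).
apply/seteqP; split=> w.
  by move/(liminf_drift_path _ _ v_gt0 (s0 w) (s_incr^~ w)).
by move=> H; apply/(liminf_drift_path _ _ v_gt0 (s0 w) (s_incr^~ w)).
Qed.

Let f x := f_infty P v sigma xi x.

Let mescape x : measurable [set w | escape v (x, seqs_of spacing jump_factor w)].
Proof.
have H := measurable_xsection x (@measurable_escape R v).
have := measurable_seqs_of mtau malpha measurableT H.
rewrite setTI; congr measurable; apply/seteqP; split=> w.
  by move/set_mem.
by move=> ?; apply/mem_set.
Qed.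

Lemma escape_probE x : p x = (f x)%:E.
Proof. by rewrite /f f_infty_escape_prob fineK// fin_num_measure. Qed.

Lemma f_infty_ge0 x : 0 <= f x.
Proof. by rewrite -lee_fin -escape_probE. Qed.

Lemma f_infty_le1 x : f x <= 1.
Proof. by rewrite -lee_fin -escape_probE; exact: probability_le1. Qed.

Lemma f_infty_homo : {homo f : x y / x <= y}.
Proof.
move=> x y xy; rewrite -lee_fin -!escape_probE.
apply: le_measure; rewrite ?inE; [exact: mescape|exact: mescape|].
by move=> w /=; apply: escape_homo => // i; exact: expR_ge0.
Qed.

Lemma f_infty_eq0 x : x <= 0 -> f x = 0.
Proof.
move=> x0; apply/eqP; rewrite -eqe -escape_probE; apply/eqP.
rewrite /p /escape_prob (_ : [set _ | _] = set0) ?measure0//.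
apply/seteqP; split=> // w /= /escape_gt0 => /(_ (ltW v_gt0)).
have [_ s_incr _ _] := sigma_poisson.
move=> H; suff: 0 < x by rewrite ltNge x0.
apply: H => i /=; last exact: expR_ge0.
by rewrite subr_ge0 ltW.
Qed.

Hypothesis mu_pos : mu `]0%R, +oo[%classic = 1%E.

Let F x := scaled_mean mu 0 f x.

Let mf : measurable_fun setT f.
Proof.
apply/measurable_EFinP; rewrite (_ : EFin \o f = p).
  exact: measurable_escape_prob.
by apply/funext => x; rewrite /= escape_probE.
Qed.

(** [mu_pos] makes the nonpositive factors negligible, and boundedness of [f] makes the integral
    finite. *)
Lemma mean_escape_prob y :
  (\int[mu]_b p (b * y)%R = (F y)%:E)%E.
Proof.
have mpy : measurable_fun [set: R] (fun b => p (b * y)).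
  by apply: measurableT_comp; [exact: measurable_escape_prob|exact: measurable_funM].
rewrite (@ge0_negligible_integral _ R R mu setT (`]-oo, 0%R]%classic : set R))//=.
  rewrite setTD setCitvl /F /scaled_mean /Rintegral fineK.
    by apply: eq_integral => b _; rewrite expr0 mul1r escape_probE.
  apply: (@integrable_fin_num _ R R mu).
    by [].
  apply: (@integrable_scaled _ mu 0 f 1) => //.
    rewrite /finite_moment; under eq_integral do rewrite expr0.
    rewrite integral_cst// mul1e.
    by apply: le_lt_trans (ltry 1); exact: probability_le1.
  by move=> z; rewrite ger0_norm ?f_infty_ge0 ?f_infty_le1.
have := @probability_setC _ _ _ mu `]0, +oo[%classic (measurable_itv _).
by rewrite mu_pos setCitvr subee.
Qed.



Let moment0 : finite_moment mu 0.
Proof.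
rewrite /finite_moment; under eq_integral do rewrite expr0.
rewrite integral_cst// mul1e.
by apply: le_lt_trans (ltry 1); exact: probability_le1.
Qed.

Let f_bound y : `|f y| <= 1.
Proof. by rewrite ger0_norm ?f_infty_ge0 ?f_infty_le1. Qed.

Let mq : measurable_fun setT (fun y => \int[mu]_b p (b * y)%R)%E.
Proof.
apply: (@measurable_fun_fubini_tonelli_F _ _ R R R mu (fun z => p (z.2 * z.1))) => //.
apply: measurableT_comp; first exact: measurable_escape_prob.
by apply: measurable_funM; [exact: measurable_snd|exact: measurable_fst].
Qed.

Let F_homo : {homo F : y z / y <= z}.
Proof.
move=> y z yz; apply: le_Rintegral => //.
- exact: (integrable_scaled y moment0 mf f_bound).
- exact: (integrable_scaled z moment0 mf f_bound).
move=> b; rewrite /= in_itv/= andbT => b0; rewrite !expr0 !mul1r.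
by apply: f_infty_homo; rewrite ler_pM2l.
Qed.

Let F_ge0 y : 0 <= F y.
Proof.
by apply: Rintegral_ge0 => // b _; rewrite expr0 mul1r f_infty_ge0.
Qed.

Let F_le1 y : F y <= 1.
Proof.
rewrite -lee_fin -mean_escape_prob.
apply: (@le_trans _ _ (\int[mu]_b cst 1 b)%E).
  apply: ge0_le_integral => //.
  - apply: measurableT_comp; last exact: measurable_funM.
    exact: measurable_escape_prob.
  - by move=> b _; rewrite escape_probE lee_fin f_infty_le1.
by rewrite integral_cst// mul1e; exact: probability_le1.
Qed.

Variable a1 : R.
Hypotheses (a1_gt0 : 0 < a1) (vE : v = lambda * a1).

Let f_renewal x t : 0 <= t ->
  F x * (1 - expR (- (t / a1))) + (1 - (1 - expR (- (t / a1)))) * f x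
    <= f (x + t) <=
  F (x + t) * (1 - expR (- (t / a1))) + (1 - (1 - expR (- (t / a1)))) * f x.
Proof.
move=> t0.
(* The drift covers the distance [t] in time [t / v], and [v = lambda * a1] turns the exponent
   [lambda * (t / v)] into [t / a1]. *)
have h0 : 0 <= t / v by rewrite divr_ge0// ltW.
have vh : v * (t / v) = t by rewrite mulrCA divff ?mulr1// gt_eqF.
have lh : lambda * (t / v) = t / a1.
  by rewrite vE; field; rewrite !gt_eqF.
have q_ge0 y : (0%R <= \int[mu]_b p (b * y)%R)%E by rewrite mean_escape_prob lee_fin.
have q_homo : {homo (fun y => \int[mu]_b p (b * y)%R)%E : y z / y <= z >-> (y <= z)%E}.
  by move=> y z yz; rewrite !mean_escape_prob lee_fin F_homo.
have := exponential_renewal_bounds lambda_gt0 spacing_lawE x v_gt0 h0 mq q_ge0 q_homo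
  (escape_prob_renewal mtau malpha cylinder_law v).
have pE y : escape_prob P spacing jump_factor v y = (f y)%:E := escape_probE y.
rewrite vh lh !mean_escape_prob !pE -!EFinM -!EFinD !lee_fin.
by rewrite (_ : 1 - (1 - expR (- (t / a1))) = expR (- (t / a1)))//; ring.
Qed.

(** The renewal bounds serve twice: they make [f] and thereby [F] continuous, and then give the
    derivative. *)
Lemma f_infty_is_derive (x : R) : is_derive x 1 f ((F x - f x) / a1).
Proof.
apply: (renewal_is_derive a1_gt0 f_infty_ge0 f_infty_le1 F_ge0 F_le1 f_renewal).
apply: (continuous_scaled_mean moment0 _ f_bound).
exact: (renewal_continuous a1_gt0 f_infty_ge0 f_infty_le1 F_ge0 F_le1 f_renewal).
Qed.

End jump_data.

Unset Implicit Arguments.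
Set Strict Implicit.

Theorem mainTheorem3 (R : realType) (a1 : R) (a1_gt0 : 0 < a1)
    (mu : probability (measurableTypeR R) R)
    (mu_pos : mu `]0%R, +oo[%classic = 1%E)
    (mu_ln : (\int[mu]_(a in `]0%R, +oo[) `|ln a|%:E < +oo)%E)
    (K_gt0 : (0 < \int[mu]_(a in `]0%R, +oo[) (ln a)%:E)%E)
    (lambda : R) (lambda_gt0 : 0 < lambda)
    (d : measure_display) (T : measurableType d) (P : probability T R)
    (sigma xi : nat -> {RV P >-> R})
    (sigma_poisson : poisson_arrival_times P lambda sigma)
    (xi_indep : mutually_independent P xi)
    (xi_law : forall i, has_law P (fun w => expR (xi i w)) mu)
    (sigma_xi_indep : independent_sequences P sigma xi) :
  let f := f_infty P (lambda * a1) sigma xi in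
  (forall x : R, x <= 0 -> f x = 0) /\
  (forall k : nat, (0 < k)%N ->
     ((\int[mu]_(a in `]0%R, +oo[) (a ^+ k.-1)%:E < +oo)%E ->
        times_derivable k f 0) /\
     derive1n k f 0 = 0).
Proof.
have v_gt0 : 0 < lambda * a1 by rewrite mulr_gt0.
have mid : measurable_fun setT (idfun : measurableTypeR R -> R).
  by move=> _ A mA; rewrite setTI.
(* [mu] is a measure on [measurableTypeR R], which has the same measurable sets
   as [R] but is another structure. *)
pose mu' : probability R R :=
  @distribution _ _ (measurableTypeR R) R R mu (@mfun_Sub _ _ (measurableTypeR R) R idfun (mem_set mid)).
have mu'_pos : mu' `]0%R, +oo[%classic = 1%E := mu_pos.
have xi_law' i : has_law P (fun w => expR (xi i w)) mu' := xi_law i.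
move=> f.
have f0 x : x <= 0 -> f x = 0.
  exact: (f_infty_eq0 xi v_gt0 sigma_poisson).
have df := f_infty_is_derive lambda_gt0 v_gt0 sigma_poisson xi_indep xi_law'
  sigma_xi_indep mu'_pos a1_gt0 erefl.
have f_ge0 := f_infty_ge0 xi v_gt0 sigma_poisson.
have f_le1 := f_infty_le1 xi v_gt0 sigma_poisson.
split; first exact: f0.
(* With the order written [k.+1], the assumed moment has order [k], as [times_derivable_moment]
   requires. *)
move=> [//|k] _; split; last first.
  apply: derive1n_eq0_left => //.
move=> mk; apply: (times_derivable_moment f_ge0 f_le1 df).
(* The moment of [mu'] is that of [mu], by change of variables along the identity. *)
rewrite /finite_moment [X in (X < _)%E](ge0_integral_pushforward mid mu)//.
- by apply/measurable_EFinP; apply: measurable_funX.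
- by move=> b; rewrite inE /= in_itv/= andbT => b0; rewrite lee_fin exprn_ge0 ?ltW.
Qed.
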